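(* Let $A$ and $B$ be groups containing elements of infinite order, and let $G=A\ast B$ be their free product. Suppose that the abelianization $G_{ab}=G/[G,G]$ is infinite and that $\mathrm{Rat}(A)$ and $\mathrm{Rat}(B)$ are Boolean algebras. Then for every proper word $w$ the set $w[G]$ is not rational in $G$.
   Context: A word is an element $w=w(x_1,\dots,x_n)$ of the free group $F(X)$ with basis $X=\{x_1,x_2,\dots\}$. For a group $G$, $w[G]=\{w(g_1,\dots,g_n) : g_1,\dots,g_n\in G\}$. The word $w$ is proper if there exist groups $G$ and $H$ such that $w[G]\neq \{1\}$ and $w[H]\neq H$. For a monoid $M$, the family $\mathrm{Rat}(M)$ of rational subsets of $M$ is the smallest family of subsets of $M$ that contains all finite subsets and is closed under union, product $L_1L_2=\{ab : a\in L_1, b\in L_2\}$, and submonoid generation $L\mapsto L^{\ast}$. A subset of a group $G$ is rational in $G$ if it belongs to $\mathrm{Rat}(G)$. $\mathrm{Rat}(G)$ is a Boolean algebra if it is closed under intersections and complements in $G$ (it is always closed under unions). *)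

(* Defs.v *)
From HB Require Import structures.
From mathcomp Require Import all_boot.
From mathcomp Require Import boolp classical_sets cardinality.

Set Implicit Arguments.
Unset Strict Implicit.
Unset Printing Implicit Defensive.

Local Open Scope classical_set_scope.
Local Open Scope group_scope.

Section Morphism.
Variables (G H : groupType) (h : {multiplicative G -> H}).

Lemma morph1 : h 1 = 1.
Proof. by apply: (mulgI (h 1)); rewrite -gmulfM !mulg1. Qed.

Lemma morphV x : h x^-1 = (h x)^-1.
Proof. by apply/esym/mulg1_eq; rewrite -gmulfM mulgV morph1. Qed.

End Morphism.

(* The free group on X, as reduced words; the letter (x, false) stands for x
   and (x, true) for its inverse.  The product multiplies letter by letter with
   cancellation; fg_eval_gen and fg_eval_uniq are the universal property. *)

Section FreeGroup.
Variable X : choiceType.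
Implicit Types (l : X * bool) (s t : seq (X * bool)).

Definition letter_inv l : X * bool := (l.1, ~~ l.2).

Definition reduced s := sorted (fun l l' => l' != letter_inv l) s.

Record free_group := FreeGroup { fg_word : seq (X * bool); _ : reduced fg_word }.

HB.instance Definition _ := [isSub for fg_word].
HB.instance Definition _ := [Choice of free_group by <:].

Definition fg_push l s :=
  if s is l' :: s' then if l' == letter_inv l then s' else l :: s else [:: l].

Definition fg_cat s t := foldr fg_push t s.

Lemma letter_invK : involutive letter_inv.
Proof. by case=> x b; rewrite /letter_inv /= negbK. Qed.

Lemma reduced_push l s : reduced s -> reduced (fg_push l s).
Proof.
case: s => [|l' s] //= Hs; case: ifPn => [_|H]; first exact: path_sorted Hs.
by rewrite /= H.
Qed.

Lemma fg_push_cons l s : reduced (l :: s) -> fg_push l s = l :: s.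
Proof. by case: s => [|l' s] //= /andP[/negPf->]. Qed.

Lemma fg_pushK l s : reduced s -> fg_push (letter_inv l) (fg_push l s) = s.
Proof.
case: s => [|l' s] /=; first by rewrite letter_invK eqxx.
move=> Hs; case: eqP => [<-|_]; first exact: fg_push_cons.
by rewrite /= letter_invK eqxx.
Qed.

Lemma reduced_cat s t : reduced t -> reduced (fg_cat s t).
Proof. by move=> Ht; elim: s => //= l s; apply: reduced_push. Qed.

Lemma fg_cat_push l s t :
  reduced t -> fg_cat (fg_push l s) t = fg_push l (fg_cat s t).
Proof.
move=> Ht; case: s => [|l' s] //=; case: eqP => // ->.
by rewrite -{1}[l]letter_invK fg_pushK //; apply: reduced_cat.
Qed.

Lemma fg_catA r s t : reduced t -> fg_cat r (fg_cat s t) = fg_cat (fg_cat r s) t.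
Proof. by move=> Ht; elim: r => //= l r ->; rewrite fg_cat_push. Qed.

Lemma fg_cats0 s : reduced s -> fg_cat s [::] = s.
Proof.
elim: s => //= l s IHs Hs; rewrite IHs ?fg_push_cons //; exact: path_sorted Hs.
Qed.

Definition fg_inv_seq s := rev (map letter_inv s).

Lemma reduced_inv s : reduced s -> reduced (fg_inv_seq s).
Proof.
rewrite /reduced rev_sorted sorted_map; apply: sub_sorted => l l' /=.
by apply: contraNneq => ->; rewrite letter_invK.
Qed.

Lemma fg_invK s : fg_inv_seq (fg_inv_seq s) = s.
Proof. by rewrite /fg_inv_seq map_rev revK (mapK letter_invK). Qed.

Lemma fg_catV s : reduced s -> fg_cat (fg_inv_seq s) s = [::].
Proof.
elim: s => //= l s IHs Hs; rewrite /fg_cat /fg_inv_seq map_cons rev_cons.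
rewrite foldr_rcons /= letter_invK eqxx; apply: IHs; exact: path_sorted Hs.
Qed.

Definition fg_one := @FreeGroup [::] isT.
Definition fg_mul (u v : free_group) : free_group :=
  FreeGroup (reduced_cat (fg_word u) (valP v)).
Definition fg_inv (u : free_group) : free_group :=
  FreeGroup (reduced_inv (valP u)).

Fact fg_mulA : associative fg_mul.
Proof. by move=> u v w; apply/val_inj/fg_catA/valP. Qed.
Fact fg_mul1 : left_id fg_one fg_mul.
Proof. by move=> u; apply/val_inj. Qed.
Fact fg_mulr1 : right_id fg_one fg_mul.
Proof. by move=> u; apply/val_inj/fg_cats0/valP. Qed.
Fact fg_mulV : left_inverse fg_one fg_inv fg_mul.
Proof. by move=> u; apply/val_inj/fg_catV/valP. Qed.
Fact fg_mulrV : right_inverse fg_one fg_inv fg_mul.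
Proof.
move=> u; rewrite -[u in fg_mul u _](_ : fg_inv (fg_inv u) = u) ?fg_mulV //.
by apply/val_inj/fg_invK.
Qed.

HB.instance Definition _ :=
  isGroup.Build free_group fg_mulA fg_mul1 fg_mulr1 fg_mulV fg_mulrV.

Definition fg_gen (x : X) : free_group := @FreeGroup [:: (x, false)] isT.

Section Eval.
Variables (G : groupType) (g : X -> G).

Definition eval_letter l : G := if l.2 then (g l.1)^-1 else g l.1.

Definition fg_eval (u : free_group) : G := \prod_(l <- fg_word u) eval_letter l.

Lemma eval_letter_inv l : eval_letter (letter_inv l) = (eval_letter l)^-1.
Proof. by case: l => x []; rewrite /eval_letter //= invgK. Qed.

Lemma fg_evalM : {morph fg_eval : u v / u * v}.
Proof.
move=> [s Hs] [t Ht]; rewrite /fg_eval /=.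
elim: s {Hs} => [|l s IHs] /=; first by rewrite big_nil mul1g.
rewrite big_cons -mulgA -IHs; case: fg_cat => [|l' r] /=.
  by rewrite big_seq1 big_nil mulg1.
case: eqP => [->|_]; rewrite !big_cons //.
by rewrite eval_letter_inv mulVKg.
Qed.

HB.instance Definition _ := isMultiplicative.Build free_group G fg_eval fg_evalM.

Lemma fg_eval_gen x : fg_eval (fg_gen x) = g x.
Proof. by rewrite /fg_eval big_seq1. Qed.

Lemma fg_eval_uniq (h : {multiplicative free_group -> G}) :
  (forall x, h (fg_gen x) = g x) -> h =1 fg_eval.
Proof.
move=> hg [s Hs]; rewrite /fg_eval /=.
elim: s Hs => [|l s IHs] Hs; first by rewrite big_nil -(morph1 h); congr (h _); apply/val_inj.
have Hs' := path_sorted Hs.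
have -> : FreeGroup Hs = @FreeGroup [:: l] isT * FreeGroup Hs'.
  by apply/val_inj; rewrite /= fg_push_cons.
rewrite gmulfM big_cons IHs; congr (_ * _); case: l {Hs Hs' IHs} => x b.
rewrite /eval_letter /= -hg; case: b; last by congr (h _); apply/val_inj.
by rewrite -morphV; congr (h _); apply/val_inj.
Qed.

End Eval.
End FreeGroup.

(* The free product of A and B, as alternating sequences of nontrivial elements
   of A and B.  The product multiplies syllable by syllable, merging adjacent
   syllables from the same factor; fp_eval_inl, fp_eval_inr and fp_eval_uniq are
   the universal property. *)

Section FreeProduct.
Variables A B : groupType.
Implicit Types (k l m n : A + B) (s t : seq (A + B)).

Definition syl_triv l := match l with inl a => a == 1 | inr b => b == 1 end.

Definition syl_mul l l' : option (A + B) :=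
  match l, l' with
  | inl a, inl a' => Some (inl (a * a'))
  | inr b, inr b' => Some (inr (b * b'))
  | _, _ => None
  end.

Definition syl_inv l : A + B :=
  match l with inl a => inl a^-1 | inr b => inr b^-1 end.

Definition alternate l l' : bool :=
  match l, l' with inl _, inr _ | inr _, inl _ => true | _, _ => false end.

Definition normal_form s := all (predC syl_triv) s && sorted alternate s.

Record free_product :=
  FreeProduct { fp_word : seq (A + B); _ : normal_form fp_word }.

HB.instance Definition _ := [isSub for fp_word].
HB.instance Definition _ := [Choice of free_product by <:].

Definition fp_push l s :=
  if syl_triv l then s else
  if s is l' :: s' then
    if syl_mul l l' is Some m then if syl_triv m then s' else m :: s'
    else l :: s
  else [:: l].

Definition fp_cat s t := foldr fp_push t s.

Lemma alternateE l l' : alternate l l' = (syl_mul l l' == None).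
Proof. by case: l l' => [?|?] [?|?]. Qed.

Lemma syl_mul1 l l' m : syl_mul l l' = Some m -> syl_triv l -> m = l'.
Proof. by case: l l' => [?|?] [?|?] //= [<-] /eqP->; rewrite mul1g. Qed.

Lemma syl_mulr1 l l' m : syl_mul l l' = Some m -> syl_triv l' -> m = l.
Proof. by case: l l' => [?|?] [?|?] //= [<-] /eqP->; rewrite mulg1. Qed.

Lemma syl_mulA l l' m k n :
  syl_mul l l' = Some m -> syl_mul l' k = Some n -> syl_mul l n = syl_mul m k.
Proof.
by case: l l' k => [?|?] [?|?] [?|?] //= [<-] [<-] /=; rewrite mulgA.
Qed.

Lemma syl_mul_some l l' m k n :
  syl_mul l l' = Some m -> syl_mul l' k = Some n -> syl_mul m k != None.
Proof. by case: l l' k => [?|?] [?|?] [?|?] //= [<-]. Qed.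

Lemma alternate_mul l l' m : syl_mul l l' = Some m -> alternate m =1 alternate l'.
Proof. by case: l l' => [?|?] [?|?] //= [<-]. Qed.

Lemma syl_invK : involutive syl_inv.
Proof. by case=> ? /=; rewrite invgK. Qed.

Lemma syl_triv_inv l : syl_triv (syl_inv l) = syl_triv l.
Proof. by case: l => ? /=; rewrite invg_eq1. Qed.

Lemma syl_mulV l : exists2 m, syl_mul (syl_inv l) l = Some m & syl_triv m.
Proof. by case: l => ? /=; eexists; rewrite // mulVg /= eqxx. Qed.

Lemma normal_cons l s :
  normal_form (l :: s) = [&& ~~ syl_triv l, path alternate l s & normal_form s].
Proof.
rewrite /normal_form /= -andbA; case: syl_triv => //=.
case: s => //= k s; case: alternate; rewrite /= ?andbF //.
by case: syl_triv => //=; case: path; rewrite ?andbF ?andbT.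
Qed.

Lemma normal_tail l s : normal_form (l :: s) -> normal_form s.
Proof. by rewrite normal_cons => /and3P[]. Qed.

Lemma normal_swap l k s :
  ~~ syl_triv l -> alternate l =1 alternate k ->
  normal_form (k :: s) -> normal_form (l :: s).
Proof.
rewrite !normal_cons => -> E /and3P[_ Hp ->]; rewrite andbT /=.
by case: s Hp => //= k' s; rewrite E.
Qed.

Lemma normal_push l s : normal_form s -> normal_form (fp_push l s).
Proof.
rewrite /fp_push; case: ifPn => // Hl; case: s => [|l' s] Hs.
  by rewrite normal_cons Hl.
case E: syl_mul => [m|].
  case: ifPn => Hm; first exact: normal_tail Hs.
  exact: normal_swap (alternate_mul E) Hs.
rewrite normal_cons Hl Hs andbT /= alternateE E /=.
by move: Hs; rewrite normal_cons => /and3P[].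
Qed.

Lemma fp_push_cons l s : normal_form (l :: s) -> fp_push l s = l :: s.
Proof.
rewrite normal_cons /fp_push => /and3P[/negPf-> Hp _].
by case: s Hp => //= k s /andP[]; rewrite alternateE => /eqP->.
Qed.

Lemma fp_push_mul l l' m s :
  normal_form s -> syl_mul l l' = Some m ->
  fp_push l (fp_push l' s) = fp_push m s.
Proof.
move=> Hs E; have [Tl|Tl] := boolP (syl_triv l).
  by rewrite (syl_mul1 E Tl) {1}/fp_push Tl.
have [Tl'|Tl'] := boolP (syl_triv l').
  by rewrite (syl_mulr1 E Tl') [fp_push l' s]/fp_push Tl'.
case: s Hs => [_|k s Hs].
  by rewrite /fp_push (negPf Tl) (negPf Tl') E.
have Tk : ~~ syl_triv k by move: Hs; rewrite normal_cons => /and3P[].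
rewrite [fp_push l' _]/fp_push (negPf Tl').
case E': (syl_mul l' k) => [n|]; last first.
  rewrite /fp_push (negPf Tl) E; have := alternate_mul E k.
  by rewrite !alternateE E' eqxx => /eqP->; case: ifP.
have En := syl_mulA E E'; have := syl_mul_some E E'.
case Ep: (syl_mul m k) => [p|] // _; rewrite Ep in En.
have [Tn|Tn] := boolP (syl_triv n).
  have epl := syl_mulr1 En Tn.
  rewrite fp_push_cons; last first.
    by apply: normal_swap Hs; rewrite // -epl; apply: alternate_mul Ep.
  rewrite /fp_push Ep epl (negPf Tl); case: ifPn => // Tm.
  by rewrite -epl (syl_mul1 Ep Tm).
rewrite /fp_push (negPf Tl) En Ep; case: ifPn => [Tp|Tp]; case: ifPn => // Tm.
  by move: Tp; rewrite (syl_mul1 Ep Tm) (negPf Tk).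
by rewrite (syl_mul1 Ep Tm).
Qed.

Lemma normal_cat s t : normal_form t -> normal_form (fp_cat s t).
Proof. by move=> Ht; elim: s => //= l s; apply: normal_push. Qed.

Lemma fp_cat_push l s t :
  normal_form t -> fp_cat (fp_push l s) t = fp_push l (fp_cat s t).
Proof.
move=> Ht; rewrite {1}/fp_push; case: ifP => [Tl|_]; first by rewrite /fp_push Tl.
case: s => [|k s] //; case E: syl_mul => [m|] //=.
rewrite (fp_push_mul _ E) ?normal_cat //.
by case: ifP => // Tm; rewrite /fp_push Tm.
Qed.

Lemma fp_catA r s t : normal_form t -> fp_cat r (fp_cat s t) = fp_cat (fp_cat r s) t.
Proof. by move=> Ht; elim: r => //= l r ->; rewrite fp_cat_push. Qed.

Lemma fp_cats0 s : normal_form s -> fp_cat s [::] = s.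
Proof.
elim: s => //= l s IHs Hs; rewrite IHs ?fp_push_cons //; exact: normal_tail Hs.
Qed.

Definition fp_inv_seq s := rev (map syl_inv s).

Lemma normal_inv s : normal_form s -> normal_form (fp_inv_seq s).
Proof.
rewrite /normal_form all_rev all_map rev_sorted sorted_map => /andP[Ht Hs].
rewrite (eq_all (a2 := predC syl_triv)) ?Ht /=; last first.
  by move=> l /=; rewrite syl_triv_inv.
by apply: sub_sorted Hs => -[?|?] [?|?].
Qed.

Lemma fp_invK s : fp_inv_seq (fp_inv_seq s) = s.
Proof. by rewrite /fp_inv_seq map_rev revK (mapK syl_invK). Qed.

Lemma fp_catV s : normal_form s -> fp_cat (fp_inv_seq s) s = [::].
Proof.
elim: s => //= l s IHs Hs; rewrite /fp_cat /fp_inv_seq map_cons rev_cons.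
rewrite foldr_rcons {2}/fp_push syl_triv_inv; have [m -> ->] := syl_mulV l.
move: Hs; rewrite normal_cons => /and3P[/negPf-> _]; exact: IHs.
Qed.

Definition fp_one := @FreeProduct [::] isT.
Definition fp_mul (u v : free_product) : free_product :=
  FreeProduct (normal_cat (fp_word u) (valP v)).
Definition fp_inv (u : free_product) : free_product :=
  FreeProduct (normal_inv (valP u)).

Fact fp_mulA : associative fp_mul.
Proof. by move=> u v w; apply/val_inj/fp_catA/valP. Qed.
Fact fp_mul1 : left_id fp_one fp_mul.
Proof. by move=> u; apply/val_inj. Qed.
Fact fp_mulr1 : right_id fp_one fp_mul.
Proof. by move=> u; apply/val_inj/fp_cats0/valP. Qed.
Fact fp_mulV : left_inverse fp_one fp_inv fp_mul.
Proof. by move=> u; apply/val_inj/fp_catV/valP. Qed.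
Fact fp_mulrV : right_inverse fp_one fp_inv fp_mul.
Proof.
move=> u; rewrite -[u in fp_mul u _](_ : fp_inv (fp_inv u) = u) ?fp_mulV //.
by apply/val_inj/fp_invK.
Qed.

HB.instance Definition _ :=
  isGroup.Build free_product fp_mulA fp_mul1 fp_mulr1 fp_mulV fp_mulrV.

Definition fp_syl l : free_product :=
  FreeProduct (normal_push l (isT : normal_form [::])).

Definition fp_inl (a : A) : free_product := fp_syl (inl a).
Definition fp_inr (b : B) : free_product := fp_syl (inr b).

Lemma fp_sylM l l' m : syl_mul l l' = Some m -> fp_syl m = fp_syl l * fp_syl l'.
Proof.
move=> E; apply/val_inj; rewrite /= fp_cat_push ?normal_push //.
by rewrite /= (fp_push_mul _ E).
Qed.

Fact fp_inlM : {morph fp_inl : x y / x * y}.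
Proof. by move=> x y; apply: fp_sylM. Qed.
Fact fp_inrM : {morph fp_inr : x y / x * y}.
Proof. by move=> x y; apply: fp_sylM. Qed.

HB.instance Definition _ := isMultiplicative.Build A free_product fp_inl fp_inlM.
HB.instance Definition _ := isMultiplicative.Build B free_product fp_inr fp_inrM.

Section Eval.
Variables (H : groupType) (f : {multiplicative A -> H}) (g : {multiplicative B -> H}).

Definition eval_syl l : H := match l with inl a => f a | inr b => g b end.

Definition fp_eval (u : free_product) : H := \prod_(l <- fp_word u) eval_syl l.

Lemma eval_syl1 l : syl_triv l -> eval_syl l = 1.
Proof. by case: l => ? /= /eqP->; apply: morph1. Qed.

Lemma eval_sylM l l' m :
  syl_mul l l' = Some m -> eval_syl m = eval_syl l * eval_syl l'.
Proof. by case: l l' => [?|?] [?|?] //= [<-]; apply: gmulfM. Qed.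

Lemma eval_push l s :
  \prod_(k <- fp_push l s) eval_syl k = eval_syl l * \prod_(k <- s) eval_syl k.
Proof.
rewrite /fp_push; case: ifP => [/eval_syl1->|_]; first by rewrite mul1g.
case: s => [|k s]; first by rewrite big_seq1 big_nil mulg1.
case E: syl_mul => [m|]; last by rewrite big_cons.
rewrite big_cons mulgA -(eval_sylM E).
by case: ifP => [/eval_syl1->|_]; rewrite ?mul1g ?big_cons.
Qed.

Lemma fp_evalM : {morph fp_eval : u v / u * v}.
Proof.
move=> [s Hs] [t Ht]; rewrite /fp_eval /=.
elim: s {Hs} => [|l s IHs] /=; first by rewrite big_nil mul1g.
by rewrite eval_push IHs big_cons mulgA.
Qed.

HB.instance Definition _ :=
  isMultiplicative.Build free_product H fp_eval fp_evalM.

Lemma fp_eval_inl a : fp_eval (fp_inl a) = f a.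
Proof. by rewrite /fp_eval eval_push big_nil mulg1. Qed.

Lemma fp_eval_inr b : fp_eval (fp_inr b) = g b.
Proof. by rewrite /fp_eval eval_push big_nil mulg1. Qed.

Lemma fp_eval_uniq (h : {multiplicative free_product -> H}) :
  (forall a, h (fp_inl a) = f a) -> (forall b, h (fp_inr b) = g b) ->
  h =1 fp_eval.
Proof.
move=> hf hg [s Hs]; rewrite /fp_eval /=.
elim: s Hs => [|l s IHs] Hs.
  by rewrite big_nil -(morph1 h); congr (h _); apply/val_inj.
have -> : FreeProduct Hs = fp_syl l * FreeProduct (normal_tail Hs).
  by apply/val_inj; rewrite /= fp_cat_push ?(normal_tail Hs) //= fp_push_cons.
by rewrite gmulfM big_cons IHs; case: l {Hs IHs} => c; rewrite ?hf ?hg.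
Qed.

End Eval.
End FreeProduct.

Definition word : Type := free_group nat.

Definition verbal_set (w : word) (G : groupType) : set G :=
  [set x | exists g : nat -> G, x = fg_eval g w].
Arguments verbal_set w G : clear implicits.

Definition proper_word (w : word) : Prop :=
  exists G H : groupType, verbal_set w G <> [set 1] /\ verbal_set w H <> setT.

Section Rational.
Variable M : monoidType.

Definition prod_set (L1 L2 : set M) : set M :=
  [set x | exists a b, [/\ L1 a, L2 b & x = a * b]].

Definition is_submonoid (N : set M) : Prop :=
  N 1 /\ forall x y, N x -> N y -> N (x * y).

Definition submonoid_gen (L : set M) : set M := smallest is_submonoid L.

Inductive rational : set M -> Prop :=
| rational_finite L : finite_set L -> rational L
| rational_union L1 L2 : rational L1 -> rational L2 -> rational (L1 `|` L2)
| rational_prod L1 L2 : rational L1 -> rational L2 -> rational (prod_set L1 L2)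
| rational_gen L : rational L -> rational (submonoid_gen L).

End Rational.

Definition rat_boolean_algebra (G : groupType) : Prop :=
  (forall L1 L2 : set G, rational L1 -> rational L2 -> rational (L1 `&` L2)) /\
  (forall L : set G, rational L -> rational (~` L)).

Definition infinite_order (G : groupType) (x : G) : Prop :=
  forall n : nat, (0 < n)%N -> x ^+ n <> 1.

Section Abelianization.
Variable G : groupType.

Definition is_subgroup (K : set G) : Prop :=
  [/\ K 1, forall x y, K x -> K y -> K (x * y) & forall x, K x -> K x^-1].

Definition commutator_subgroup : set G :=
  smallest is_subgroup [set z | exists x y : G, z = [~ x, y]].

Definition left_coset (K : set G) (x : G) : set G := [set y | K (x^-1 * y)].

(* The underlying set of G / [G, G]. *)
Definition abelianization : set (set G) :=
  range (left_coset commutator_subgroup).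

End Abelianization.
Arguments abelianization G : clear implicits.

(* Main.v *)
Require Import Defs.
From mathcomp Require Import all_boot ssralg ssrint.
From mathcomp Require Import boolp classical_sets cardinality.

Set Implicit Arguments.
Unset Strict Implicit.
Unset Printing Implicit Defensive.

(** Why the theorem is true.  A rational subset of a free product G = A * B
cannot see more than finitely many properties of each single syllable, whereas
the values of a proper word satisfy a congruence on syllable counts that sees
infinitely many syllables b^n at once.

A rational set L is recognized by a finite automaton whose labels are single
syllables (rational_recognized).  Cancellation in a free product is nested, so
a run with product x can be cut into runs whose products are the successive
syllables of the normal form of x (reach_runs).  Only the set of pairs of
states joined by a run with product l matters for a syllable l, and there are
finitely many such sets; hence the syllables can be coloured by finitely many
colours so that L is stable under replacing any syllables of a normal form by
syllables of the same colours (rational_recolor).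

On the other side, fix b of infinite order in B.  For n > 0 count the syllables
b^n in a normal form with sign +, and the syllables b^-n with sign -.  This
count is additive under multiplication except for the at most three syllables
that meet where the two normal forms stop cancelling (weight_fp_cat).  Hence for
all but a number of n bounded in terms of the word w alone, the count for n of a
value w(g_1, g_2, ...) is the sum over i of e_i c_i, where e_i is the exponent
sum of x_i in w and c_i is the count for n of g_i (weight_fg_eval).  If such a
sum were 1, then substituting x_i := h^(c_i) in w would give h, in any group H
and for any h in H, so that w[H] = H for every H (verbal_set_full).

It remains to contradict this for a proper w with w[G] rational.  Since w is
not the empty word, an explicit substitution yields a value h whose normal form
begins and ends with a syllable of B (B_bordered_test_value).  Pick distinct
positive u_1, ..., u_m, v_1, ..., v_m, with m large, such that all the syllables
b^-u_j and b^-v_j have the same colour.  With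
z(u) = a b^u_1 ... a b^u_m, the conjugate z(u)^-1 h z(u) is in w[G] and is
reduced as written, so z(v)^-1 h z(u) is in w[G] as well.  But the
count of this element for u_j is 1 whenever b^u_j and b^-u_j do not occur in h,
and there are more such u_j than the bounded number of exceptions. *)

Import GRing.Theory.
Local Open Scope classical_set_scope.
Local Open Scope group_scope.

(** * Rational sets are recognized by finite automata *)

Section Automata.
Variable M : monoidType.

Inductive reach (Q : Type) (E : Q -> M -> Q -> Prop) : Q -> M -> Q -> Prop :=
| reach_refl p : reach E p 1 p
| reach_step p m q x r : E p m q -> reach E q x r -> reach E p (m * x) r.

Lemma reach_trans Q (E : Q -> M -> Q -> Prop) p x q y r :
  reach E p x q -> reach E q y r -> reach E p (x * y) r.
Proof.
move=> H; elim: H y r => {p x q} [p|p m q x r' Em _ IH] y r Hy; first by rewrite mul1g.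
by rewrite -mulgA; apply: reach_step Em _; apply: IH.
Qed.

Lemma reach_edge Q (E : Q -> M -> Q -> Prop) p m q : E p m q -> reach E p m q.
Proof. by move=> Em; rewrite -[m]mulg1; apply: reach_step Em _; apply: reach_refl. Qed.

Lemma reach_map Q Q' (E : Q -> M -> Q -> Prop) (E' : Q' -> M -> Q' -> Prop)
    (j : Q -> Q') p x q :
  (forall p m q, E p m q -> E' (j p) m (j q)) ->
  reach E p x q -> reach E' (j p) x (j q).
Proof.
move=> Ej; elim=> {p x q} [p|p m q x r Em _ IH]; first exact: reach_refl.
exact: reach_step (Ej _ _ _ Em) IH.
Qed.

Variable D : set M.

(** Only the states are required to be finite in number: recolouring counts pairs
of states, and any set of edges between them will do. *)
Definition recognized (L : set M) : Prop :=
  exists (Q : finType) (E : Q -> M -> Q -> Prop) (I F : Q -> Prop),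
    (forall p m q, E p m q -> D m) /\
    forall x, L x <-> exists i f, [/\ I i, F f & reach E i x f].

Lemma recognized_set0 : recognized set0.
Proof.
exists unit, (fun _ _ _ => False), (fun=> False), (fun=> False).
by split=> // x; split=> // -[? [? []]].
Qed.

Lemma recognized_set1 m : D m -> recognized [set m].
Proof.
move=> Dm; pose E p x q := [/\ p = false, q = true & x = m].
exists bool, E, (fun p => p = false), (fun p => p = true).
split=> [p x q [_ _ ->] //|x]; split=> [->|[_ [_ [-> -> R]]]].
  by exists false, true; split=> //; apply: reach_edge.
suff inv p y q : reach E p y q -> (p = q /\ y = 1) \/ (p = false /\ y = m).
  by case: (inv _ _ _ R) => -[].
elim=> {p y q} [p|p y q z r [-> -> ->] _ [[_ ->]|[]]] //; first by left.
by right; rewrite mulg1.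
Qed.

Lemma recognizedU L1 L2 : recognized L1 -> recognized L2 -> recognized (L1 `|` L2).
Proof.
case=> Q1 [E1 [I1 [F1 [D1 H1]]]] [Q2 [E2 [I2 [F2 [D2 H2]]]]].
pose E (p : Q1 + Q2) m (q : Q1 + Q2) :=
  match p, q with
  | inl p, inl q => E1 p m q | inr p, inr q => E2 p m q | _, _ => False end.
pose S (P1 : Q1 -> Prop) (P2 : Q2 -> Prop) (p : Q1 + Q2) :=
  match p with inl p => P1 p | inr p => P2 p end.
have inv p x q : reach E p x q ->
    match p, q with
    | inl p, inl q => reach E1 p x q
    | inr p, inr q => reach E2 p x q | _, _ => False end.
  elim=> {p x q} [[p|p]|p m q x r]; try exact: reach_refl.
  by case: p => p; case: q => q; case: r => r //= Em _; apply: reach_step.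
exists (Q1 + Q2)%type, E, (S I1 I2), (S F1 F2); split.
  by case=> p m [q|q] //=; [apply: D1|apply: D2].
move=> x; split=> [[/H1|/H2] [i [f [Ii Ff R]]]|[[i|i] [[f|f] [Ii Ff /inv R]]]] //.
- by exists (inl i), (inl f); split=> //; apply: reach_map R.
- by exists (inr i), (inr f); split=> //; apply: reach_map R.
- by left; apply/H1; exists i, f.
- by right; apply/H2; exists i, f.
Qed.

(** Edges labelled 1 serve as silent transitions in the next two constructions. *)
Hypothesis D1 : D 1.

Lemma recognizedM L1 L2 :
  recognized L1 -> recognized L2 -> recognized (prod_set L1 L2).
Proof.
case=> Q1 [E1 [I1 [F1 [DE1 H1]]]] [Q2 [E2 [I2 [F2 [DE2 H2]]]]].
pose E (p : Q1 + Q2) m (q : Q1 + Q2) :=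
  match p, q with
  | inl p, inl q => E1 p m q | inr p, inr q => E2 p m q
  | inl p, inr q => [/\ F1 p, I2 q & m = 1] | _, _ => False end.
(* A run from the first automaton to the second crosses exactly one bridge. *)
have inv p x q : reach E p x q ->
    match p, q with
    | inl p, inl q => True
    | inr p, inr q => reach E2 p x q
    | inl p, inr q => exists x1 x2 f i,
       [/\ reach E1 p x1 f, F1 f, I2 i, reach E2 i x2 q & x = x1 * x2]
    | _, _ => False end.
  elim=> {p x q} [[p|p] //|p m q x r]; first exact: reach_refl.
  case: p => p; case: q => q; case: r => r //= Em _.
  - case=> x1 [x2 [f [i [R1 Ff Ii R2 ->]]]].
    by exists (m * x1), x2, f, i; split=> //; [apply: reach_step R1|rewrite mulgA].
  - move=> R; case: Em => Fp Iq ->; exists 1, x, p, q.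
    by split=> //; first apply: reach_refl.
  - by move=> R; apply: reach_step R.
exists (Q1 + Q2)%type, E, (fun p => if p is inl p then I1 p else False),
  (fun p => if p is inr p then F2 p else False); split.
  by case=> p m [q|q] //=; [apply: DE1|case=> _ _ ->|apply: DE2].
move=> x; split=> [[x1 [x2 [/H1 [i [f [Ii Ff R1]]] /H2 [i' [f' [Ii' Ff' R2]]] ->]]]|].
  exists (inl i), (inr f'); split=> //.
  apply: (reach_trans (q := inl f)); first exact: reach_map R1.
  rewrite -[x2]mul1g; apply: (reach_step (q := inr i')) => //; exact: reach_map R2.
case=> [[i|i] [[f|f] [Ii Ff /inv]]] // [x1 [x2 [f1 [i2 [R1 Ff1 Ii2 R2 ->]]]]].
by exists x1, x2; split=> //; [apply/H1; exists i, f1|apply/H2; exists i2, f].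
Qed.

Lemma recognized_gen L : recognized L -> recognized (submonoid_gen L).
Proof.
case=> Q [E0 [I [F [DE H]]]].
(* The extra state None is a hub: each excursion from it reads an element of L. *)
pose E (p : option Q) m (q : option Q) :=
  match p, q with
  | Some p, Some q => E0 p m q
  | None, Some q => I q /\ m = 1 | Some p, None => F p /\ m = 1
  | None, None => False end.
exists (option Q), E, (fun p => p = None), (fun p => p = None); split.
  by case=> [p|] m [q|] //=; [apply: DE|case=> _ ->|case=> _ ->].
move=> x; split=> [Lx|[_ [_ [-> -> R]]] N [[N1 NM] LN]].
  exists None, None; split=> //; apply: (Lx (fun x => reach E None x None)).
  split; first by split=> [|y z]; [apply: reach_refl|apply: reach_trans].
  move=> y /H [i [f [Ii Ff R]]]; rewrite -[y]mul1g.
  apply: (reach_step (q := Some i)) => //; rewrite -[y]mulg1.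
  apply: (reach_trans (q := Some f)); first exact: reach_map R.
  exact: reach_edge.
pose T (p : option Q) x := match p with
  | None => N x
  | Some p => exists x1 x2 f, [/\ reach E0 p x1 f, F f, N x2 & x = x1 * x2] end.
suff {x R} inv p x q : reach E p x q -> q = None -> T p x by apply: inv R _.
elim=> {p x q} [p -> //|p m q x r Em _ IH /IH {IH}].
case: p Em => [p|]; case: q => [q|] //= Em.
- case=> x1 [x2 [f [R Ff Nx ->]]]; exists (m * x1), x2, f.
  by split=> //; [apply: reach_step R|rewrite mulgA].
- by case: Em => Fp -> Nx; exists 1, x, p; split=> //; apply: reach_refl.
- case: Em => Iq -> [x1 [x2 [f [R Ff Nx ->]]]]; rewrite mul1g; apply: NM => //.
  by apply: LN; apply/H; exists q, f.
Qed.

(** The automaton may be asked to read only labels from a prescribed generating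
set D: this is what later makes its edges single syllables. *)
Lemma rational_recognized L :
  (forall x, submonoid_gen D x) -> rational L -> recognized L.
Proof.
move=> genD.
have rec1 x : recognized [set x].
  apply: (genD x (fun x => recognized [set x])); split; last exact: recognized_set1.
  split=> [|y z Ry Rz]; first exact: recognized_set1.
  have -> : [set y * z] = prod_set [set y] [set z].
    by apply/seteqP; split=> [_ ->|_ [_ [_ [-> -> ->]]]] //; exists y, z.
  exact: recognizedM.
elim=> {L} [L /finite_seqP [s ->]|L1 L2 _ R1 _ R2|L1 L2 _ R1 _ R2|L _ R].
- elim: s => [|x s IH].
    by rewrite set_nil; apply: recognized_set0.
  have -> : [set` x :: s] = [set x] `|` [set` s].
    apply/seteqP; split=> y /=; rewrite in_cons.
      by case/predU1P; [left|right].
    by case=> [->|->]; rewrite ?eqxx ?orbT.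
  exact: recognizedU.
- exact: recognizedU.
- exact: recognizedM.
- exact: recognized_gen.
Qed.

End Automata.

(** * Recolouring the syllables of a rational subset of a free product *)

Section Substitution.
Variables A B : groupType.
Implicit Types (l k : A + B) (s t : seq (A + B)) (x y : free_product A B).

Lemma fp_syl_triv l : syl_triv l -> fp_syl l = 1.
Proof. by move=> Tl; apply/val_inj; rewrite /= /fp_push Tl. Qed.

Lemma fp_word_mul_syl l x : fp_word (fp_syl l * x) = fp_push l (fp_word x).
Proof. by rewrite /= fp_cat_push //; apply: valP. Qed.

Lemma fp_word_prod s : fp_word (\prod_(l <- s) fp_syl l) = fp_cat s [::].
Proof.
by elim: s => [|l s IHs]; rewrite ?big_nil // big_cons fp_word_mul_syl IHs.
Qed.

Lemma fp_wordK x : \prod_(l <- fp_word x) fp_syl l = x.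
Proof. by apply/val_inj; rewrite /= fp_word_prod fp_cats0 //; apply: valP. Qed.

Section Runs.
Variables (Q : Type) (E : Q -> free_product A B -> Q -> Prop).
Hypothesis E_syl : forall p x q, E p x q -> range (@fp_syl A B) x.

(** A run cut at the syllables of s.  On the empty word it is still a run with
product 1, possibly a long one, because cancelled syllables leave a trace. *)
Fixpoint runs p s q : Prop :=
  if s is l :: s' then exists2 r, reach E p (fp_syl l) r & runs r s' q
  else reach E p 1 q.

Lemma runs_reach p s q : runs p s q -> reach E p (\prod_(l <- s) fp_syl l) q.
Proof.
elim: s p => [|l s IHs] p /=; first by rewrite big_nil.
by case=> r Rl /IHs; rewrite big_cons; apply: reach_trans.
Qed.

Lemma runs_silent p r s q : reach E p 1 r -> runs r s q -> runs p s q.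
Proof.
case: s => [|l s] /= Hp; first by rewrite -[in X in _ -> X](mulg1 1); apply: reach_trans.
by case=> r' Rl Rs; exists r' => //; rewrite -[fp_syl l]mul1g; apply: reach_trans Rl.
Qed.

(** Merging two syllables concatenates their runs; if they cancel, the result is
a silent run, absorbed by whatever follows. *)
Lemma runs_push p l r s q :
  reach E p (fp_syl l) r -> runs r s q -> runs p (fp_push l s) q.
Proof.
rewrite /fp_push => Rl; case: ifP => [/fp_syl_triv El|_].
  by apply: runs_silent; rewrite -El.
case: s => [|k s] Rs; first by exists r.
case Em: syl_mul => [m|]; last by exists r.
case: Rs => r' Rk Rs.
have Rm : reach E p (fp_syl m) r' by rewrite (fp_sylM Em); apply: reach_trans Rk.
case: ifP => [/fp_syl_triv E1|_]; last by exists r'.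
by apply: runs_silent Rs; rewrite -E1.
Qed.

Lemma reach_runs p x q : reach E p x q -> runs p (fp_word x) q.
Proof.
elim=> {p x q} [p|p m q x r Em _ IH]; first exact: reach_refl.
have [l _ El] := E_syl Em; rewrite -El fp_word_mul_syl; apply: runs_push IH.
by rewrite El; apply: reach_edge.
Qed.

End Runs.

(** The colour of a syllable is the set of pairs of states that it can join, so a
cut run for x is also a cut run for any word with the same colours. *)
Lemma rational_recolor (L : set (free_product A B)) :
  rational L -> exists (C : finType) (color : A + B -> C), forall x s,
    L x -> map color s = map color (fp_word x) -> L (\prod_(l <- s) fp_syl l).
Proof.
move=> ratL.
have one_syl : range (@fp_syl A B) 1 by exists (inl 1) => //; apply/fp_syl_triv/eqxx.
have gen_syl x : submonoid_gen (range (@fp_syl A B)) x.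
  rewrite -(fp_wordK x); move=> N [[N1 NM] DN]; elim: (fp_word x) => [|l s IHs].
    by rewrite big_nil.
  by rewrite big_cons; apply: NM; [apply: DN; exists l|].
have [Q [E [I [F [E_syl LP]]]]] := rational_recognized one_syl gen_syl ratL.
pose color l := [set pq : Q * Q | `[< reach E pq.1 (fp_syl l) pq.2 >]]%SET.
have color_reach l k p q : color l = color k ->
    reach E p (fp_syl k) q -> reach E p (fp_syl l) q.
  move=> /setP/(_ (p, q)); rewrite !inE => e R.
  by apply/asboolP; rewrite e; apply/asboolP.
exists {set Q * Q}%type, color => x s /LP [i [f [Ii Ff /(reach_runs E_syl) R]]] Es.
apply/LP; exists i, f; split=> //; apply: runs_reach.
elim: s (fp_word x) i {Ii} Es R => [|l s IHs] [|k t] i //= [Elk Est] [r Rk Rt].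
by exists r; [apply: color_reach Rk|apply: IHs Rt].
Qed.

End Substitution.

(** * Exponent sums *)

Definition signed (l : nat * bool) (z : int) : int := (if l.2 then - z else z)%R.

Definition exponent_sum (w : word) (n : nat -> int) : int :=
  (\sum_(l <- fg_word w) signed l (n l.1))%R.

Section IntPower.
Variables (G : groupType) (x : G).

Definition zpow (z : int) : G :=
  match z with Posz n => x ^+ n | Negz n => x ^- n.+1 end.

Lemma zpowB p q : zpow (p%:Z - q%:Z)%R = x ^+ p / x ^+ q.
Proof.
have [le_qp|lt_pq] := leqP q p; first by rewrite subzn //= expgnFr.
rewrite -opprB subzn ?(ltnW lt_pq) // -{2}(subnK (ltnW lt_pq)).
have [k ->] : exists k, q - p = k.+1 by exists (q - p).-1; rewrite prednK ?subn_gt0.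
by rewrite -NegzE /= expgnDr invgM mulVKg.
Qed.

Lemma int_subP (z : int) : exists p q : nat, z = (p%:Z - q%:Z)%R.
Proof.
by case: z => n; [exists n, 0; rewrite subr0|exists 0, n.+1; rewrite sub0r NegzE].
Qed.

Lemma zpowD y z : zpow (y + z)%R = zpow y * zpow z.
Proof.
have [p [q ->]] := int_subP y; have [p' [q' ->]] := int_subP z.
rewrite addrACA -opprD -!PoszD !zpowB !expgnDr invgM -!mulgA; congr (_ * _).
rewrite mulgA; apply/esym; have cXX m : commute (x ^+ q) (x ^+ m) by apply: commuteX2.
by apply/commuteM; [|apply: commuteV]; apply/commute_sym/commuteV/commute_sym.
Qed.

Lemma zpowN z : zpow (- z)%R = (zpow z)^-1.
Proof.
have [p [q ->]] := int_subP z; by rewrite opprB !zpowB invgF.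
Qed.

End IntPower.

(** Substituting the powers x^(n i) of a single element x turns w into
x^(exponent_sum w n). *)
Lemma verbal_set_full (w : word) (n : nat -> int) (H : groupType) :
  exponent_sum w n = 1%R -> verbal_set w H = setT.
Proof.
move=> wn; apply/seteqP; split=> // x _; exists (fun i => zpow x (n i)).
suff <- : zpow x (exponent_sum w n) = fg_eval (fun i => zpow x (n i)) w by rewrite wn.
rewrite /exponent_sum /fg_eval.
elim: (fg_word w) => [|l s IHs]; first by rewrite !big_nil.
rewrite !big_cons zpowD IHs; congr (_ * _).
by rewrite /signed /eval_letter; case: l.2; rewrite ?zpowN.
Qed.

(** * Signed syllable counts are almost additive *)

Section Weights.
Variables A B : groupType.
Implicit Types (l k : A + B) (s t d : seq (A + B)) (x y : free_product A B).

Lemma normal_cat_cons s l t :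
  normal_form (s ++ l :: t) = normal_form (rcons s l) && normal_form (l :: t).
Proof.
case: s => [|k s]; rewrite /normal_form /=; first by case: syl_triv; rewrite ?andbF.
rewrite cat_path rcons_path all_cat all_rcons /=.
case: syl_triv; case: syl_triv; case: all; case: all; case: path; case: path;
  by case: alternate.
Qed.

Lemma normal_rcons_swap s l k :
  ~~ syl_triv l -> alternate l =1 alternate k ->
  normal_form (rcons s k) -> normal_form (rcons s l).
Proof.
have alt_sym l1 l2 : alternate l1 l2 = alternate l2 l1 by case: l1 l2 => [?|?] [?|?].
move=> Tl Elk; case: s => [|m s]; rewrite /normal_form /= ?Tl //.
rewrite !rcons_path !all_rcons /= Tl !(alt_sym (last m s)) Elk.
by case: syl_triv; case: syl_triv.
Qed.

Lemma fp_cat_normal s t : normal_form (s ++ t) -> fp_cat s t = s ++ t.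
Proof.
elim: s => //= l s IHs Hst; rewrite IHs ?fp_push_cons //; exact: normal_tail Hst.
Qed.

Definition weight (psi : A + B -> int) s : int := (\sum_(l <- s) psi l)%R.

(** Oddness makes a cancelled part contribute nothing: it occurs once in each
factor, with opposite weights. *)
Definition odd_weight (psi : A + B -> int) : Prop :=
  forall l, psi (syl_inv l) = (- psi l)%R.

Lemma weight_cat psi s t : weight psi (s ++ t) = (weight psi s + weight psi t)%R.
Proof. exact: big_cat. Qed.

Lemma weight_cons psi l s : weight psi (l :: s) = (psi l + weight psi s)%R.
Proof. exact: big_cons. Qed.

Lemma weight_inv psi s : odd_weight psi ->
  weight psi (fp_inv_seq s) = (- weight psi s)%R.
Proof.
move=> odd_psi; rewrite /weight big_rev /= big_map -sumrN.
by apply: eq_bigr => l _; apply: odd_psi.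
Qed.

Definition null_on d (psi : A + B -> int) : Prop := {in d, forall l, psi l = 0%R}.

(** In s t a maximal part cancels, and then at most two syllables l and l' merge
into a third one m; additivity can fail only by psi m - psi l - psi l'.  The
exceptional list d does not depend on psi, so that one list serves the
infinitely many counts at once. *)
Lemma weight_fp_cat s t : normal_form s -> normal_form t ->
  exists2 d, size d <= 3 & forall psi, odd_weight psi -> null_on d psi ->
    weight psi (fp_cat s t) = (weight psi s + weight psi t)%R.
Proof.
have simple u v : normal_form (u ++ v) -> exists2 d, size d <= 3 &
    forall psi, odd_weight psi -> null_on d psi ->
    weight psi (fp_cat u v) = (weight psi u + weight psi v)%R.
  by move=> Huv; exists [::] => // psi _ _; rewrite fp_cat_normal // weight_cat.
elim/last_ind: s t => [|s l IHs] t Hsl Ht; first by apply: simple.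
have Tl : ~~ syl_triv l by case/andP: Hsl; rewrite all_rcons => /andP[].
case: t Ht => [|l' t] Ht; first by apply: simple; rewrite cats0.
have Tl' : ~~ syl_triv l' by move: Ht; rewrite normal_cons => /and3P[].
case El: (syl_mul l l') => [m|]; last first.
  apply: simple; rewrite cat_rcons normal_cat_cons Hsl normal_cons Tl Ht /=.
  rewrite alternateE El andbT /=; by move: Ht; rewrite normal_cons => /and3P[].
have cat_sl u : weight u (rcons s l) = (weight u s + u l)%R.
  by rewrite -cats1 weight_cat /weight big_seq1.
rewrite /fp_cat foldr_rcons /= {2}/fp_push (negPf Tl) El; case: ifPn => Tm.
  have Hs : normal_form s.
    move: Hsl; rewrite /normal_form all_rcons => /andP[/andP[_ ->]].
    by case: (s) => //= k s'; rewrite rcons_path => /andP[].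
  have [d size_d dP] := IHs t Hs (normal_tail Ht).
  exists d => // psi odd_psi psi0; rewrite [LHS]dP // cat_sl weight_cons.
  have -> : l' = syl_inv l.
    case: l l' m El Tm {Hsl Ht Tl Tl' cat_sl} => [x|x] [y|y] m //= [<-];
      by move=> /eqP /mulg1_eq <-.
  by rewrite odd_psi addrA addrK.
exists [:: l; l'; m] => // psi _ psi0.
have alt_m : alternate m =1 alternate l.
  by case: l l' El {Hsl Ht Tl Tl' cat_sl psi0} => [x|x] [y|y] //= [<-].
rewrite [foldr _ _ _]fp_cat_normal; last first.
  rewrite normal_cat_cons (normal_rcons_swap Tm alt_m Hsl) /=.
  exact: normal_swap (alternate_mul El) Ht.
by rewrite cat_sl weight_cat !weight_cons !psi0 ?inE ?eqxx ?orbT // addr0.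
Qed.

(** Each letter of w costs at most three exceptional syllables, whatever the
elements substituted for the variables. *)
Lemma weight_fg_eval (g : nat -> free_product A B) (w : word) :
  exists2 d, size d <= 3 * size (fg_word w) &
  forall psi, odd_weight psi -> null_on d psi ->
    weight psi (fp_word (fg_eval g w)) =
    exponent_sum w (fun i => weight psi (fp_word (g i))).
Proof.
rewrite /fg_eval /exponent_sum; elim: (fg_word w) => [|l s [d size_d dP]].
  by exists [::] => // psi _ _; rewrite !big_nil /weight big_nil.
rewrite !big_cons; set y := \prod_(j <- s) _ in dP *.
have [d' size_d' d'P] := weight_fp_cat (valP (eval_letter g l)) (valP y).
exists (d' ++ d) => [|psi odd_psi psi0]; first by rewrite size_cat mulnS leq_add.
rewrite [LHS]d'P // => [|k kd]; last by apply: psi0; rewrite mem_cat kd.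
rewrite dP // => [|k kd]; last by apply: psi0; rewrite mem_cat kd orbT.
rewrite big_cons; congr (_ + _)%R; rewrite /signed /eval_letter.
by case: l.2 => //; apply: weight_inv.
Qed.

End Weights.

(** * Auxiliary facts *)

Lemma monochromatic_naturals (C : finType) (f : nat -> C) (K : nat) :
  exists c ns, [/\ uniq ns, size ns = K, {in ns, forall n, 0 < n} &
                 {in ns, forall n, f n = c}].
Proof.
set r := iota 1 (#|C| * K).+1.
have [/existsP [c le_K]|none] := boolP [exists c, K <= count (fun n => f n == c) r].
  exists c, (take K [seq n <- r | f n == c]).
  have sub n : n \in take K [seq n <- r | f n == c] -> f n = c /\ n \in r.
    by move/mem_take; rewrite mem_filter => /andP[/eqP].
  split; first by rewrite take_uniq // filter_uniq // iota_uniq.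
  - by rewrite size_takel // size_filter.
  - by move=> n /sub[_]; rewrite mem_iota => /andP[].
  - by move=> n /sub[].
have: size r <= #|C| * K.
  rewrite -sum1_size (partition_big f predT) //= -sum_nat_const leq_sum // => c _.
  rewrite sum1_count ltnW // ltnNge.
  by apply: contra none => le_K; apply/existsP; exists c.
by rewrite size_iota ltnn.
Qed.

Lemma infinite_order_inj (G : groupType) (x : G) : infinite_order x ->
  injective (fun n => x ^+ n).
Proof.
move=> ord_x; suff le m n : x ^+ m = x ^+ n -> m <= n.
  by move=> m n e; apply/eqP; rewrite eqn_leq !le.
move=> e; rewrite leqNgt; apply/negP => lt_nm; apply: (ord_x (m - n)).
  by rewrite subn_gt0.
by rewrite expgnFr ?(ltnW lt_nm) // e mulgV.
Qed.

Lemma infinite_order_neqV (G : groupType) (x : G) m n : infinite_order x ->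
  0 < m -> x ^+ m != x ^- n.
Proof.
move=> ord_x m_gt0; rewrite -mulg_eq1 -expgnDr; apply/eqP/ord_x.
by rewrite addn_gt0 m_gt0.
Qed.

Lemma verbal_setJ (w : word) (G : groupType) (x z : G) :
  verbal_set w G x -> verbal_set w G (x ^ z).
Proof.
case=> g ->; exists (fun i => g i ^ z); rewrite /fg_eval conjg_prod.
by apply: eq_bigr => l _; rewrite /eval_letter; case: l.2; rewrite ?conjVg.
Qed.

Lemma fp_word_normal (A B : groupType) (s : seq (A + B)) :
  normal_form s -> fp_word (\prod_(l <- s) fp_syl l) = s.
Proof. by move=> Hs; rewrite fp_word_prod fp_cats0. Qed.

Lemma prod_fp_inv_seq (A B : groupType) (s : seq (A + B)) :
  \prod_(l <- fp_inv_seq s) fp_syl l = (\prod_(l <- s) fp_syl l)^-1.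
Proof.
rewrite -[s in RHS]revK -prodgV /fp_inv_seq -map_rev big_map; apply: eq_bigr => l _.
apply/esym/mulg1_eq; have [m /fp_sylM e Tm] := syl_mulV (syl_inv l).
by rewrite syl_invK in e; rewrite -e fp_syl_triv.
Qed.

Lemma fp_inv_seq_cat (A B : groupType) (s t : seq (A + B)) :
  fp_inv_seq (s ++ t) = fp_inv_seq t ++ fp_inv_seq s.
Proof. by rewrite /fp_inv_seq map_cat rev_cat. Qed.

(** * Verbal sets in a free product are not rational *)

Section FreeProductVerbal.
Variables (A B : groupType) (a : A) (b : B).
Hypotheses (a_neq1 : a != 1) (b_inf : infinite_order b).
Implicit Types (l k : A + B) (s t : seq (A + B)).

Definition in_B l := if l is inr _ then true else false.

(** Such words can be followed or preceded by a syllable of A without any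
merging.  The default inl 1 makes the empty word fail the test. *)
Definition B_bordered s :=
  [&& normal_form s, in_B (head (inl 1) s) & in_B (last (inl 1) s)].

Lemma B_bordered_inv s : B_bordered s -> B_bordered (fp_inv_seq s).
Proof.
have in_BV l : in_B (syl_inv l) = in_B l by case: l.
case/and3P=> Hs; rewrite /B_bordered normal_inv //= /fp_inv_seq.
case: s Hs => [//|l s] _ /= Bl Bs.
rewrite rev_cons last_rcons in_BV Bl andbT -rev_cons -map_cons.
case/lastP: s Bs => [|s k] /=; rewrite ?in_BV //.
by rewrite last_rcons map_rcons -rcons_cons rev_rcons /= in_BV.
Qed.

Definition spell (ns : seq nat) : seq (A + B) :=
  flatten [seq [:: inl a; inr (b ^+ n)] | n <- ns].

Lemma B_bordered_spell s ns : {in ns, forall n, 0 < n} ->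
  B_bordered s -> B_bordered (s ++ spell ns).
Proof.
elim: ns s => [|n ns IHns] s ns_gt0 Bs; first by rewrite cats0.
have -> : s ++ spell (n :: ns) = (s ++ [:: inl a; inr (b ^+ n)]) ++ spell ns.
  by rewrite -catA.
apply: IHns.
  by move=> k kn; apply: ns_gt0; rewrite inE kn orbT.
have bn : b ^+ n != 1 by apply/eqP/b_inf/ns_gt0/mem_head.
case/and3P: Bs; case: s => //= l s; rewrite /B_bordered /= last_cat /=.
rewrite /normal_form /= cat_path all_cat /= => /andP[/andP[-> ->] ->] -> /=.
by case: (last l s) => //= _ _; rewrite a_neq1 bn.
Qed.

(** Substituting b^(i+1) a b^(i+1) for x_i: between the letters a^(+-1) of the
value stand the products b^(+-(i+1)) b^(+-(j+1)), which are trivial only if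
x_j^(+-1) cancels x_i^(+-1) in the word. *)
Definition test_subst (i : nat) : free_product A B :=
  fp_syl (inr (b ^+ i.+1)) * fp_syl (inl a) * fp_syl (inr (b ^+ i.+1)).

Definition sgnpow (G : groupType) (x : G) (e : bool) : G := if e then x^-1 else x.

Lemma eval_test_subst (l : nat * bool) :
  eval_letter test_subst l =
  fp_syl (inr (sgnpow (b ^+ l.1.+1) l.2)) *
  (fp_syl (inl (sgnpow a l.2)) * fp_syl (inr (sgnpow (b ^+ l.1.+1) l.2))).
Proof.
case: l => i [] /=; rewrite /eval_letter /= /test_subst -?mulgA //.
by rewrite !invgM -!(morphV (@fp_inl A B)) -!(morphV (@fp_inr A B)) -mulgA.
Qed.

Lemma B_bordered_test_value (s0 : seq (nat * bool)) : reduced s0 -> s0 != [::] ->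
  B_bordered (fp_word (\prod_(l <- s0) eval_letter test_subst l)).
Proof.
have sgn1 (G : groupType) (x : G) e : x != 1 -> sgnpow x e != 1.
  by case: e; rewrite //= invg_eq1.
have bn1 n : b ^+ n.+1 != 1 by apply/eqP/b_inf.
case: s0 => // l s0 Hs _.
(* Keeping the first two syllables explicit is what allows the induction: the
   next letter to the left merges with the first one only. *)
suff [t [-> tn tl]] : exists t,
  [/\ fp_word (\prod_(k <- l :: s0) eval_letter test_subst k) =
      inr (sgnpow (b ^+ l.1.+1) l.2) :: inl (sgnpow a l.2) :: t,
      normal_form (inl (sgnpow a l.2) :: t) & in_B (last (inl 1) t)].
  move: (tn); rewrite /B_bordered !normal_cons => /and3P[-> /= -> ->].
  by rewrite sgn1 //; case: t tl {tn}.
elim: s0 l Hs => [|l' s0 IHs] l Hs;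
  rewrite big_cons eval_test_subst -!mulgA !fp_word_mul_syl.
  rewrite big_nil /=; exists [:: inr (sgnpow (b ^+ l.1.+1) l.2)].
  by rewrite /fp_push /= !(negPf (sgn1 _ _ _ _)) // /normal_form /= !sgn1.
have [t [-> tn tl]] := IHs l' (path_sorted Hs).
pose c := sgnpow (b ^+ l.1.+1) l.2 * sgnpow (b ^+ l'.1.+1) l'.2.
have c1 : c != 1.
  move: Hs => /= /andP[]; rewrite /c; case: l l' {c IHs tn tl} => i e [j e'] /=.
  rewrite /letter_inv /= => ne _; case: e e' ne => [] [] ne /=; last 1 first.
  - by rewrite -expgnDr; apply/eqP/b_inf.
  - by rewrite -invgM -expgnDr invg_eq1; apply/eqP/b_inf.
  - rewrite mulg_eq1 eqg_inv; apply: contra ne => /eqP.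
    by move=> /(infinite_order_inj b_inf) [->]; apply: eqxx.
  - rewrite mulg_eq1 invgK; apply: contra ne => /eqP.
    by move=> /(infinite_order_inj b_inf) [->]; apply: eqxx.
exists (inr c :: inl (sgnpow a l'.2) :: t).
rewrite {3}/fp_push /= (negPf (sgn1 _ _ _ _)) // -/c (negPf c1).
rewrite /fp_push /= !(negPf (sgn1 _ _ _ _)) //; split=> //.
  move: (tn); rewrite !normal_cons => /and3P[-> /= -> ->].
  by rewrite sgn1 // c1.
by case: t tl {tn}.
Qed.

Definition power_weight (n : nat) l : int :=
  ((l == inr (b ^+ n)%g)%:R - (l == inr (b ^- n)%g)%:R)%R.

Lemma power_weight_odd n : odd_weight (power_weight n).
Proof.
move=> l; rewrite /power_weight opprB; congr (_%:R - _%:R)%R.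
  by rewrite (inv_eq (@syl_invK A B)) /=.
by rewrite (inv_eq (@syl_invK A B)) /= invgK.
Qed.

Lemma power_weight_spell n (ns : seq nat) : 0 < n -> {in ns, forall j, 0 < j} ->
  weight (power_weight n) (spell ns) = (count_mem n ns)%:R%R.
Proof.
move=> n_gt0; elim: ns => [|k ns IHns] ns_gt0; first by rewrite /weight big_nil.
rewrite /spell /= !weight_cons -/(spell ns) IHns => [|j jn]; last first.
  by apply: ns_gt0; rewrite inE jn orbT.
have k_gt0 := ns_gt0 _ (mem_head _ _).
rewrite natrD addrA; congr (_ + _)%R; rewrite /power_weight subrr add0r.
rewrite (inj_eq (@inr_inj A B)) (inj_eq (infinite_order_inj b_inf)).
by rewrite (inj_eq (@inr_inj A B)) (negPf (infinite_order_neqV _ _ _)) // subr0.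
Qed.

Lemma power_weight_neq0 n l :
  power_weight n l != 0%R -> inr (b ^+ n) \in [:: l; syl_inv l].
Proof.
rewrite /power_weight !inE -(inv_eq (@syl_invK A B)) /= !(eq_sym _ l).
by case: (l == _); case: (l == _).
Qed.

(** If the weight for n is nonzero on some l in d, then b^n is l or its inverse;
the factor two comes from this choice. *)
Lemma detecting_exponent d (ns : seq nat) : uniq ns -> (size d).*2 < size ns ->
  exists2 n, n \in ns & null_on d (power_weight n).
Proof.
move=> uniq_ns lt_d; apply: contrapT => none.
have: size [seq inr (b ^+ n) : A + B | n <- ns] <= size (d ++ map (@syl_inv A B) d).
  apply: uniq_leq_size => [|k /mapP[n nns ->]].
    by rewrite map_inj_uniq // => m n [] /(infinite_order_inj b_inf).
  apply/negPn/negP => notin; apply: none; exists n => // l ld.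
  apply/eqP; apply: contraNT notin => /power_weight_neq0; rewrite !inE mem_cat.
  by case/orP=> /eqP->; rewrite ?ld ?map_f ?orbT.
by rewrite size_cat !size_map addnn leqNgt lt_d.
Qed.

(** Conjugation keeps values of w among the values, and recolouring one side of
the conjugation breaks its symmetry: the counts no longer compensate. *)
Theorem verbal_set_not_rational (w : word) : proper_word w ->
  ~ rational (verbal_set w (free_product A B)).
Proof.
case=> [G [H [wG wH]]] /rational_recolor [C [color recolor]].
have w_neq1 : fg_word w != [::].
  apply/eqP => w1; apply: wG; apply/seteqP; split=> [_ [g ->]|_ ->] /=.
    by rewrite /fg_eval w1 big_nil.
  by exists (fun=> 1); rewrite /fg_eval w1 big_nil.
set h := fg_eval test_subst w.
have Bh : B_bordered (fp_word h) by apply: B_bordered_test_value (valP w) w_neq1.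
(* m exceeds twice the number of syllables in h and of exceptional syllables of
   any value of w, as detecting_exponent requires. *)
set m := (size (fp_word h) + 3 * size (fg_word w)).*2.+1.
have [c [ns [uniq_ns size_ns ns_gt0 color_ns]]] :=
  monochromatic_naturals (fun n => color (inr (b ^- n))) (m + m).
set us := take m ns; set vs := drop m ns.
have sub_us : {subset us <= ns} by move=> n; apply: mem_take.
have sub_vs : {subset vs <= ns} by move=> n; apply: mem_drop.
have size_us : size us = m by rewrite size_takel // size_ns leq_addr.
have size_vs : size vs = m by rewrite size_drop size_ns addnK.
have us_gt0 : {in us, forall n, 0 < n} by move=> n /sub_us /ns_gt0.
have vs_gt0 : {in vs, forall n, 0 < n} by move=> n /sub_vs /ns_gt0.
pose conj_word rs := fp_inv_seq (spell rs) ++ fp_word h ++ spell us.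
have normal_conj rs : {in rs, forall n, 0 < n} -> normal_form (conj_word rs).
  move=> rs_gt0; suff /and3P[] : B_bordered (conj_word rs) by [].
  rewrite /conj_word -[_ ++ spell us]fp_invK -fp_inv_seq_cat.
  by apply/B_bordered_inv/B_bordered_spell/B_bordered_inv/B_bordered_spell.
pose x := h ^ \prod_(l <- spell us) fp_syl l.
have Lx : verbal_set w (free_product A B) x by apply: verbal_setJ; exists test_subst.
have word_x : fp_word x = conj_word us.
  rewrite -[RHS]fp_word_normal ?normal_conj //; congr fp_word.
  by rewrite !big_cat /= prod_fp_inv_seq fp_wordK.
have color_eq : map color (conj_word vs) = map color (fp_word x).
  rewrite word_x !map_cat !map_rev; congr (rev _ ++ _).
  have color_us : {in us, forall n, color (inr (b ^- n)) = c}.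
    by move=> n /sub_us /color_ns.
  have color_vs : {in vs, forall n, color (inr (b ^- n)) = c}.
    by move=> n /sub_vs /color_ns.
  have : size vs = size us by rewrite size_us.
  elim: (vs) (us) color_vs color_us => [|v vs' IH] [|u us'] //= cv cu [e].
  rewrite cv ?mem_head // cu ?mem_head //; congr [:: _, _ & _].
  by apply: IH => // n Hn; [apply: cv|apply: cu]; rewrite inE Hn orbT.
(* The element z(v)^-1 h z(u) is a value of w. *)
have [g Ey] := recolor _ _ Lx color_eq.
have [d size_d dP] := weight_fg_eval g w.
(* An n that occurs only in z(u): its count is 1. *)
have [|n us_n null_n] := @detecting_exponent (fp_word h ++ d) us (take_uniq _ uniq_ns).
  by rewrite size_us /m ltnS leq_double size_cat leq_add2l.
have null_h : {in fp_word h, forall l, power_weight n l = 0%R}.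
  by move=> l lh; apply: null_n; rewrite mem_cat lh.
have null_d : null_on d (power_weight n).
  by move=> l ld; apply: null_n; rewrite mem_cat ld orbT.
have n_vs : n \notin vs.
  move: uniq_ns; rewrite -(cat_take_drop m ns) cat_uniq => /and3P[_ /hasPn disj _].
  by apply/negP => /disj /=; rewrite us_n.
apply: wH; apply: (@verbal_set_full w (fun i => weight (power_weight n) (fp_word (g i)))).
rewrite -(dP _ (power_weight_odd n) null_d) -Ey fp_word_normal ?normal_conj //.
rewrite !weight_cat weight_inv ?power_weight_spell ?us_gt0 //;
  last exact: power_weight_odd.
rewrite (count_memPn n_vs) (count_uniq_mem _ (take_uniq _ uniq_ns)) us_n.
by rewrite oppr0 add0r [weight _ (fp_word h)]big_seq big1.
Qed.

End FreeProductVerbal.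

Theorem corollary5p8 (A B : groupType)
  (hA : exists a : A, infinite_order a)
  (hB : exists b : B, infinite_order b)
  (hab : infinite_set (abelianization (free_product A B)))
  (hRatA : rat_boolean_algebra A)
  (hRatB : rat_boolean_algebra B)
  (w : word) (hw : proper_word w) :
  ~ rational (verbal_set w (free_product A B)).
Proof.
case: hA hB => a a_inf [b b_inf].
apply: (verbal_set_not_rational (a := a) _ b_inf hw).
by apply/eqP; rewrite -[a]expg1; apply: a_inf.
Qed.
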